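(* For every integer $n\geq 0$, $$11 \sum_{k=1}^{n} F_{4k} L_{6(n-k)} = 3 L_{6n} - 2F_{4n+4} + 18 F_{4n},$$ $$11 \sum_{k=1}^{n} F_{4k} L_{6(n-k)+3} = 3 L_{6n+3} - 4F_{4n+4} - 4 F_{4n},$$ $$11 \sum_{k=0}^{n} L_{4k+2} F_{6(n-k)+3} = 3 (F_{6n+9} - F_{6n+3}) - 2(L_{4n+6}-L_{4n+2}),$$ $$11 \sum_{k=0}^{n} L_{4k+2} F_{6(n-k)+6} = 3 (F_{6n+12} - F_{6n+6}) - 8L_{4n+6}.$$
   Context: $F_n$ and $L_n$ denote the Fibonacci and Lucas numbers: $F_0=0$, $F_1=1$, $L_0=2$, $L_1=1$, each satisfying $w_n=w_{n-1}+w_{n-2}$ for $n\ge 2$. A sum whose upper limit is smaller than its lower limit is $0$. *)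

(* Defs.v *)
From mathcomp Require Import all_boot all_order all_algebra.

Set Implicit Arguments.
Unset Strict Implicit.
Unset Printing Implicit Defensive.

Import GRing.Theory.

Local Open Scope ring_scope.

(* Both sequences are integer-valued, so that subtraction of their terms is
   not truncated; their indices are natural numbers. *)
Fixpoint fib (n : nat) : int :=
  match n with
  | 0%N => 0
  | 1%N => 1
  | (m.+1 as p).+1 => fib p + fib m
  end.

Fixpoint lucas (n : nat) : int :=
  match n with
  | 0%N => 2
  | 1%N => 1
  | (m.+1 as p).+1 => lucas p + lucas m
  end.

Arguments fib n%_N.
Arguments lucas n%_N.

(* Main.v *)
(** Since [w (m + 12) = 18 * w (m + 6) - w m] for both sequences (18 being the
    sixth Lucas number), each convolution satisfies an inhomogeneous second-order
    recurrence; the right-hand side satisfies the same one, with the same first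
    two values. *)
Require Import Defs.
From mathcomp Require Import all_boot all_order all_algebra.
From mathcomp Require Import ring.

Import GRing.Theory.

Local Open Scope ring_scope.

(** For [k <= n] the truncated subtraction is exact, so the recurrence of [b] applies termwise. The
    terms [k = n.+1] and [k = n.+2] remain, and [- p * b 0] offsets the last term of the sum that
    [p] multiplies. *)
Lemma conv_recS (R : comPzRingType) (p q : R) (a b : nat -> R) (n : nat) :
  (forall i, b i.+2 = p * b i.+1 + q * b i) ->
  \sum_(0 <= k < n.+3) a k * b (n.+2 - k)%N =
    p * (\sum_(0 <= k < n.+2) a k * b (n.+1 - k)%N)
    + q * (\sum_(0 <= k < n.+1) a k * b (n - k)%N)
    + a n.+2 * b 0%N + a n.+1 * (b 1%N - p * b 0%N).
Proof.
move=> b_rec.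
rewrite big_nat_recr //= big_nat_recr //= [in p * _]big_nat_recr //=.
rewrite !subnn subSnn.
have -> : \sum_(0 <= k < n.+1) a k * b (n.+2 - k)%N =
    p * (\sum_(0 <= k < n.+1) a k * b (n.+1 - k)%N)
    + q * (\sum_(0 <= k < n.+1) a k * b (n - k)%N).
  rewrite !big_distrr -big_split /=; apply: eq_big_nat => k /andP[_ le_kn].
  by rewrite !subSn ?b_rec //; [ring | exact: leqW].
by ring.
Qed.

(** Induction on two consecutive values at once, as the recurrence has order two. The factor [c]
    stays on the left so that no division is required. *)
Lemma conv_unique (R : comPzRingType) (c p q : R) (a b g : nat -> R) :
  (forall i, b i.+2 = p * b i.+1 + q * b i) ->
  g 0%N = c * (a 0%N * b 0%N) ->
  g 1%N = c * (a 0%N * b 1%N + a 1%N * b 0%N) ->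
  (forall i, g i.+2 = p * g i.+1 + q * g i
     + c * (a i.+2 * b 0%N + a i.+1 * (b 1%N - p * b 0%N))) ->
  forall n, c * (\sum_(0 <= k < n.+1) a k * b (n - k)%N) = g n.
Proof.
move=> b_rec g0 g1 g_rec n.
suff [] : c * (\sum_(0 <= k < n.+1) a k * b (n - k)%N) = g n /\
          c * (\sum_(0 <= k < n.+2) a k * b (n.+1 - k)%N) = g n.+1 by [].
elim: n => [|n [IHn IHn1]].
  by split; rewrite ?g0 ?g1 ?big_nat_recr //= big_geq // !add0r.
by split=> //; rewrite (conv_recS _ p q) // g_rec -IHn -IHn1; ring.
Qed.

(** For a numeral shift this reduces every term to [w m.+1] and [w m], the atoms left to [ring]. *)
Lemma fib_like_add (w : nat -> int) (m k : nat) :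
  (forall i, w i.+2 = w i.+1 + w i) ->
  w (m + k.+1)%N = fib k.+1 * w m.+1 + fib k * w m.
Proof.
move=> w_rec; elim: k m => [|k IHk] m; first by rewrite addn1 /=; ring.
rewrite -addSnnS IHk w_rec.
have -> : fib k.+2 = fib k.+1 + fib k by [].
by ring.
Qed.

Lemma fibD m k : fib (m + k.+1) = fib k.+1 * fib m.+1 + fib k * fib m.
Proof. exact: fib_like_add. Qed.

Lemma lucasD m k : lucas (m + k.+1) = fib k.+1 * lucas m.+1 + fib k * lucas m.
Proof. exact: fib_like_add. Qed.

(* Generalizing the products keeps [-addnA] from unfolding them into sums. *)
Ltac fib_lucas_ring i :=
  rewrite !mulnSr; move: (4 * i)%N (6 * i)%N => x y;
  rewrite -?addnA ?(fibD, lucasD) /=; ring.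

Theorem corollary10 (n : nat) :
  [/\ 11 * (\sum_(1 <= k < n.+1) fib (4 * k) * lucas (6 * (n - k)))
        = 3 * lucas (6 * n) - 2 * fib (4 * n + 4) + 18 * fib (4 * n),
      11 * (\sum_(1 <= k < n.+1) fib (4 * k) * lucas (6 * (n - k) + 3))
        = 3 * lucas (6 * n + 3) - 4 * fib (4 * n + 4) - 4 * fib (4 * n),
      11 * (\sum_(0 <= k < n.+1) lucas (4 * k + 2) * fib (6 * (n - k) + 3))
        = 3 * (fib (6 * n + 9) - fib (6 * n + 3))
          - 2 * (lucas (4 * n + 6) - lucas (4 * n + 2))
    & 11 * (\sum_(0 <= k < n.+1) lucas (4 * k + 2) * fib (6 * (n - k) + 6))
        = 3 * (fib (6 * n + 12) - fib (6 * n + 6)) - 8 * lucas (4 * n + 6)].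
Proof.
(* The term [k = 0] vanishes because [fib 0 = 0], which gives the sums the range of
   [conv_unique]. *)
have from1 (h : nat -> int) : \sum_(1 <= k < n.+1) fib (4 * k) * h k
    = \sum_(0 <= k < n.+1) fib (4 * k) * h k.
  by rewrite [RHS]big_ltn // muln0 mul0r add0r.
rewrite !from1; split.
(* Steps of 4 obey [w (m + 8) = 7 * w (m + 4) - w m], so the 6-step recurrence leaves the defect
   [-11 * w (m + 4)]: hence the factor 11 = 18 - 7. Initial values hold by computation. *)
- apply: (@conv_unique _ 11 18 (-1) (fun k => fib (4 * k))
    (fun i => lucas (6 * i))
    (fun n => 3 * lucas (6 * n) - 2 * fib (4 * n + 4) + 18 * fib (4 * n)))
    => // i; fib_lucas_ring i.
- apply: (@conv_unique _ 11 18 (-1) (fun k => fib (4 * k))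
    (fun i => lucas (6 * i + 3))
    (fun n => 3 * lucas (6 * n + 3) - 4 * fib (4 * n + 4) - 4 * fib (4 * n)))
    => // i; fib_lucas_ring i.
- apply: (@conv_unique _ 11 18 (-1) (fun k => lucas (4 * k + 2))
    (fun i => fib (6 * i + 3))
    (fun n => 3 * (fib (6 * n + 9) - fib (6 * n + 3))
       - 2 * (lucas (4 * n + 6) - lucas (4 * n + 2)))) => // i; fib_lucas_ring i.
- apply: (@conv_unique _ 11 18 (-1) (fun k => lucas (4 * k + 2))
    (fun i => fib (6 * i + 6))
    (fun n => 3 * (fib (6 * n + 12) - fib (6 * n + 6)) - 8 * lucas (4 * n + 6)))
    => // i; fib_lucas_ring i.
Qed.
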